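(* Let $n\ge3$, let $D_{2n}=\langle a,b\mid a^n=1=b^2,\ (ab)^2=1\rangle$, and let $\mathbb{F}$ be a field of characteristic $0$ or a prime $p$. Let $\sigma$ be the $\mathbb{F}$-linear extension to $\mathbb{F}D_{2n}$ of a group endomorphism of $D_{2n}$ of the form $a\mapsto a^s$, $b\mapsto a^tb$, where $0\le t\le n-1$ and: $1\le s\le n-1$ if $n$ is odd; $0\le s\le n-1$ with $s\ne0,\frac n2$ if $n$ is even. (i) If $\mathrm{char}(\mathbb{F})=0$, or $\mathrm{char}(\mathbb{F})$ is an odd prime $p$ with $\gcd(n,p)=1$, then all $\sigma$-derivations of $\mathbb{F}D_{2n}$ are inner, that is, $\mathrm{Inn}_\sigma(\mathbb{F}D_{2n})=\mathcal{D}_\sigma(\mathbb{F}D_{2n})$. In other words, $\mathrm{Out}_\sigma(\mathbb{F}D_{2n})=\{0\}$. (ii) If $\mathrm{char}(\mathbb{F})=2$, or $\mathrm{char}(\mathbb{F})=p$ with $\gcd(n,p)\ne1$, then $\mathrm{Inn}_\sigma(\mathbb{F}D_{2n})\subsetneq\mathcal{D}_\sigma(\mathbb{F}D_{2n})$. In other words, $\mathrm{Out}_\sigma(\mathbb{F}D_{2n})\neq\{0\}$.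
   Context: A $\sigma$-derivation of $\mathbb{F}D_{2n}$ is an $\mathbb{F}$-linear map $D$ from $\mathbb{F}D_{2n}$ to itself with $D(\alpha\beta)=D(\alpha)\sigma(\beta)+\sigma(\alpha)D(\beta)$ for all $\alpha,\beta$; $\mathcal{D}_\sigma(\mathbb{F}D_{2n})$ is the space of all of them. It is inner if for some $\beta\in\mathbb{F}D_{2n}$, $D(\alpha)=\beta\sigma(\alpha)-\sigma(\alpha)\beta$ for all $\alpha$; $\mathrm{Inn}_\sigma(\mathbb{F}D_{2n})$ is the subspace of inner ones, and $\mathrm{Out}_\sigma(\mathbb{F}D_{2n})=\mathcal{D}_\sigma(\mathbb{F}D_{2n})/\mathrm{Inn}_\sigma(\mathbb{F}D_{2n})$. *)

(* Defs.v *)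
From HB Require Import structures.
From mathcomp Require Import all_boot all_order all_fingroup all_algebra.
From mathcomp Require Import all_solvable.
From mathcomp Require Import ring_quotient generic_quotient boolp.

Set Implicit Arguments.
Unset Strict Implicit.
Unset Printing Implicit Defensive.

Import GRing.Theory.

Local Open Scope ring_scope.
Local Open Scope quotient_scope.

(* The presentation <a, b | a^n = 1 = b^2, (ab)^2 = 1> with designated         *)
(* generators: [set: gT] is the group so presented, and the pair (a, b)        *)
(* generates it and satisfies the relations.  The first four clauses say that  *)
(* (a, b) is the image of the formal generators under some epimorphism from    *)
(* the presented group, which by finiteness and the last clause is bijective.  *)
Definition dihedral_presentation (gT : finGroupType) (n : nat) (a b : gT) :=
  [/\ <<[set a; b]>> = [set: gT],
      a ^+ n = 1, b ^+ 2 = 1, (a * b) ^+ 2 = 1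
    & [set: gT] \isog Grp (x : y : x ^+ n, y ^+ 2, (x * y) ^+ 2)]%g.

(* The group algebra F[gT], as coefficient functions with the convolution      *)
(* product. An alias is needed because {ffun gT -> F} already carries the      *)
(* pointwise product.                                                          *)
Definition group_algebra (F : fieldType) (gT : finGroupType) : Type :=
  {ffun gT -> F^o}.

Section GroupAlgebra.
Variables (F : fieldType) (gT : finGroupType).
Local Notation FG := (group_algebra F gT).
Implicit Types u v w : FG.

HB.instance Definition _ := Vector.copy FG {ffun gT -> F^o}.

Definition gcoef u (g : gT) : F := (u : {ffun gT -> F^o}) g.

Definition gmk (f : gT -> F) : FG := [ffun g => f g : F^o].

Definition gdelta (g : gT) : FG := gmk (fun h => (h == g)%:R).

Definition gmul u v : FG :=
  gmk (fun g => \sum_(h : gT) gcoef u h * gcoef v (h^-1 * g)%g).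

Lemma gmkE f g : gcoef (gmk f) g = f g.
Proof. by rewrite /gcoef ffunE. Qed.

Lemma gcoefP u v : (forall g, gcoef u g = gcoef v g) <-> u = v.
Proof. by split=> [uv|->//]; apply/ffunP. Qed.

Lemma gcoefD u v g : gcoef (u + v) g = gcoef u g + gcoef v g.
Proof. by rewrite /gcoef ffunE. Qed.

Lemma gcoefZ c u g : gcoef (c *: u) g = c * gcoef u g.
Proof. by rewrite /gcoef ffunE. Qed.

Lemma gmulA : associative gmul.
Proof.
move=> u v w; apply/gcoefP => g; rewrite !gmkE.
under [RHS]eq_bigr => h _ do rewrite gmkE mulr_suml.
rewrite exchange_big /=; apply: eq_bigr => k _.
rewrite gmkE mulr_sumr (reindex_inj (mulgI k^-1%g)) /=.
by apply: eq_bigr => h _; rewrite mulrA invMg invgK -mulgA mulKVg.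
Qed.

Lemma gmul1l : left_id (gdelta 1%g) gmul.
Proof.
move=> u; apply/gcoefP => g; rewrite gmkE (bigD1 1%g) //= gmkE eqxx mul1r.
rewrite invg1 mul1g big1 ?addr0 // => h /negPf h1.
by rewrite gmkE h1 mul0r.
Qed.

Lemma gmul1r : right_id (gdelta 1%g) gmul.
Proof.
move=> u; apply/gcoefP => g; rewrite gmkE (bigD1 g) //= gmkE mulVg eqxx mulr1.
rewrite big1 ?addr0 // => h hg.
by rewrite gmkE -eq_mulVg1 (negPf hg) mulr0.
Qed.

Lemma gmulDl : left_distributive gmul +%R.
Proof.
move=> u v w; apply/gcoefP => g; rewrite gcoefD !gmkE -big_split /=.
by apply: eq_bigr => h _; rewrite gcoefD mulrDl.
Qed.

Lemma gmulDr : right_distributive gmul +%R.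
Proof.
move=> u v w; apply/gcoefP => g; rewrite gcoefD !gmkE -big_split /=.
by apply: eq_bigr => h _; rewrite gcoefD mulrDr.
Qed.

Lemma gdelta1_neq0 : gdelta 1%g != 0 :> FG.
Proof.
apply/eqP => /gcoefP /(_ 1%g); rewrite gmkE eqxx /gcoef ffunE => /eqP.
by rewrite oner_eq0.
Qed.

HB.instance Definition _ := GRing.Zmodule_isNzRing.Build FG
  gmulA gmul1l gmul1r gmulDl gmulDr gdelta1_neq0.

Lemma gscalerAl c u v : c *: (u * v) = (c *: u) * v.
Proof.
apply/gcoefP => g; rewrite gcoefZ !gmkE mulr_sumr.
by apply: eq_bigr => h _; rewrite gcoefZ mulrA.
Qed.

HB.instance Definition _ := GRing.Lmodule_isLalgebra.Build F FG gscalerAl.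

Lemma gscalerAr c u v : c *: (u * v) = u * (c *: v).
Proof.
apply/gcoefP => g; rewrite gcoefZ !gmkE mulr_sumr.
by apply: eq_bigr => h _; rewrite gcoefZ mulrCA.
Qed.

HB.instance Definition _ := GRing.Lalgebra_isAlgebra.Build F FG gscalerAr.

Definition linear_extension (phi : gT -> gT) (u : FG) : FG :=
  \sum_(g : gT) gcoef u g *: gdelta (phi g).

Section Derivations.
Variable sigma : FG -> FG.

Definition is_sigma_derivation (D : 'End(FG)) : Prop :=
  forall u v : FG, D (u * v) = D u * sigma v + sigma u * D v.

Definition is_inner (D : 'End(FG)) : Prop :=
  exists w : FG, forall u : FG, D u = w * sigma u - sigma u * w.

Definition Der : {pred 'End(FG)} := [pred D | `[< is_sigma_derivation D >]].

Definition Inn : {pred 'End(FG)} := [pred D | `[< is_inner D >]].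

Lemma DerP D : reflect (is_sigma_derivation D) (D \in Der).
Proof. exact: asboolP. Qed.

Lemma InnP D : reflect (is_inner D) (D \in Inn).
Proof. exact: asboolP. Qed.

Lemma Der_submod_closed : submod_closed Der.
Proof.
split=> [|c D E /DerP HD /DerP HE]; apply/DerP => u v.
  by rewrite !lfunE /= mul0r mulr0 addr0.
rewrite !add_lfunE !scale_lfunE HD HE mulrDl mulrDr scalerDr.
by rewrite -!gscalerAl -!gscalerAr addrACA.
Qed.

HB.instance Definition _ :=
  GRing.isSubmodClosed.Build F 'End(FG) Der Der_submod_closed.

Lemma Inn_submod_closed : submod_closed Inn.
Proof.
split=> [|c D E /InnP[w HD] /InnP[z HE]]; apply/InnP.
  by exists 0 => u; rewrite lfunE /= mul0r mulr0 subr0.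
exists (c *: w + z) => u.
rewrite !add_lfunE !scale_lfunE HD HE mulrDl mulrDr scalerBr.
by rewrite -gscalerAl -gscalerAr opprD addrACA.
Qed.

HB.instance Definition _ :=
  GRing.isSubmodClosed.Build F 'End(FG) Inn Inn_submod_closed.

Definition derivation_space : Type := {D : 'End(FG) | D \in Der}.

HB.instance Definition _ := SubChoice.copy derivation_space
  {D : 'End(FG) | D \in Der}.
HB.instance Definition _ := [SubChoice_isSubLmodule of derivation_space by <:].

(* This is Inn, seen inside the space Der, whenever sigma is multiplicative;   *)
(* for an arbitrary function sigma it is Inn intersected with Der.             *)
Definition inner_part : {pred derivation_space} := [pred D | val D \in Inn].

Lemma inner_part_submod_closed : submod_closed inner_part.
Proof.
split=> [|c D E HD HE]; first exact: (@rpred0 _ Inn).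
by apply: (@rpredD _ Inn); first exact: (@rpredZ _ _ Inn).
Qed.

HB.instance Definition _ := GRing.isSubmodClosed.Build F derivation_space
  inner_part inner_part_submod_closed.

Definition Out : Type := Quotient.quot inner_part.

HB.instance Definition _ := Choice.on Out.
HB.instance Definition _ := GRing.Zmodule.on Out.
HB.instance Definition _ := ZmodQuotient.on Out.

Definition Out_scale (c : F) (x : Out) : Out :=
  \pi_Out (c *: (repr x : derivation_space)).

Lemma Out_scale_pi c (D : derivation_space) :
  Out_scale c (\pi_Out D) = \pi_Out (c *: D).
Proof.
apply/eqP; rewrite -Quotient.idealrBE -scalerBr rpredZ //.
by rewrite Quotient.idealrBE reprK.
Qed.

Lemma Out_scaleA c d (x : Out) :
  Out_scale c (Out_scale d x) = Out_scale (c * d) x.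
Proof. by elim/quotW: x => D; rewrite (Out_scale_pi d D) !Out_scale_pi scalerA. Qed.

Lemma Out_scale1 : left_id 1 Out_scale.
Proof. by elim/quotW => D; rewrite Out_scale_pi scale1r. Qed.

Lemma Out_scaleDr : right_distributive Out_scale +%R.
Proof.
move=> c; elim/quotW => D; elim/quotW => E.
by rewrite -raddfD !Out_scale_pi -raddfD scalerDr.
Qed.

Lemma Out_scaleDl (x : Out) : {morph Out_scale^~ x : c d / c + d}.
Proof.
by move=> c d; elim/quotW: x => D; rewrite !Out_scale_pi -raddfD scalerDl.
Qed.

HB.instance Definition _ := GRing.Zmodule_isLmodule.Build F Out
  Out_scaleA Out_scale1 Out_scaleDr Out_scaleDl.

End Derivations.
End GroupAlgebra.

(* Main.v *)
Require Import Defs.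
From HB Require Import structures.
From mathcomp Require Import all_boot all_order all_fingroup all_algebra.
From mathcomp Require Import all_solvable.
From mathcomp Require Import ring_quotient generic_quotient.

Set Implicit Arguments.
Unset Strict Implicit.
Unset Printing Implicit Defensive.

Import GRing.Theory.

Local Open Scope ring_scope.

(** Write [phi] for the group endomorphism and [delta g] for the basis vector at
    [g]. A derivation [D] is determined by the cocycle
    [c g = D (delta g) * delta (phi g)^-1], for the action of the group on its
    algebra in which [g] conjugates by [phi g]; inner derivations correspond to
    coboundaries [w - delta (phi g) * w * delta (phi g)^-1]. So the outer
    derivations form a first cohomology group of the dihedral group.

    When the order [2 n] of the group is invertible, averaging a cocycle over
    the group shows that it is a coboundary ([Der_sub_Inn]). This works for any
    finite group.

    Otherwise some cocycle must be shown not to be a coboundary. The test is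
    [inner_gcoef]: if [phi g] commutes with [x], then [w] and its conjugate by
    [phi g] have the same coefficient at [x], so a coboundary vanishes there.
    In characteristic [2], the homomorphism to the field killing [a] and sending
    [b] to [1], times the unit, is a cocycle with coefficient [1] at [x = 1] for
    [g = b] ([noninner_char2]). If the characteristic [p] divides [n], then
    [c (a ^ k * b ^ e) = k (delta a - delta a^-1)] is well defined, since [k]
    matters modulo [p] only. It is a cocycle because [phi b], being a
    reflection, changes the sign of [delta a - delta a^-1], just as moving [b]
    past [a ^ k] changes the sign of [k]. Its value at [g = a] has coefficient
    [1] at [x = a], which commutes with [phi a]; here [n >= 3] ensures that [a]
    and [a^-1] differ ([noninner_pchar_dvd]).

    For both the order count and the well-definedness of the coordinates [k] and
    [e], the group must really have order [2 n] ([dihedral_orders]); this is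
    deduced from the presentation by comparison with a concrete dihedral group. *)

(** * The dihedral group in coordinates *)

Section Dihedral.
Local Open Scope nat_scope.
Local Open Scope group_scope.
Variables (n : nat) (gT : finGroupType) (a b : gT).
Hypotheses (n_gt1 : (1 < n)%N) (Hab : dihedral_presentation n a b).

Lemma dihedral_invb : b^-1 = b.
Proof. by case: Hab => _ _ b2 _ _; apply/eqP; rewrite eq_invg_mul -expg2 b2. Qed.

Lemma dihedral_conj : a ^ b = a^-1.
Proof.
case: Hab => _ _ _ ab2 _.
by rewrite conjgE dihedral_invb -[RHS]mulg1 -ab2 expg2 -!mulgA mulKg.
Qed.

Lemma dihedral_cycle_mul : <[a]> * <[b]> = [set: gT].
Proof.
case: Hab => gen _ _ _ _.
rewrite -norm_joinEr ?norms_cycle ?dihedral_conj ?groupV ?cycle_id //.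
by rewrite joing_idl joing_idr.
Qed.

(** The concrete dihedral group of order [2 n] is generated by elements that
    satisfy the relations, hence is a quotient of any group so presented. *)
Lemma dihedral_card_ge : (n.*2 <= #|[set: gT]|)%N.
Proof.
case: Hab => _ _ _ _ isoG.
rewrite -(card_dihedral n_gt1) leq_homg //.
rewrite isoG; have := homg_refl [set: 'D_(n.*2)]; rewrite Grp_dihedral //.
case/existsP=> -[x y] /= /eqP[gen xn y2 xy].
apply/existsP; exists (x, y); rewrite /= !xpair_eqE gen xn y2 !eqxx /=.
have yV : y^-1 = y by apply/eqP; rewrite eq_invg_mul -expg2 y2.
by rewrite expg2 -mulgA -{1}yV -conjgE xy mulgV.
Qed.

(** The orders of [a] and [b] are at most [n] and [2], so the lower bound on
    the order of the group leaves no room for any collapse. *)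
Lemma dihedral_orders :
  [/\ #[a] = n, #[b] = 2%N, <[a]> :&: <[b]> = 1 & #|[set: gT]| = n.*2].
Proof.
case: Hab => _ an b2 _ _.
have n_gt0 : (0 < n)%N := ltnW n_gt1.
have le_a : (#[a] <= n)%N by rewrite dvdn_leq // order_dvdn an.
have le_b : (#[b] <= 2)%N by rewrite dvdn_leq // order_dvdn b2.
have := mul_cardG <[a]> <[b]>; rewrite dihedral_cycle_mul => Ecard.
have le_G := dihedral_card_ge.
have I_gt0 : (0 < #|<[a]> :&: <[b]>|)%N := cardG_gt0 _.
have le_ab : (#[a] * #[b] <= n * 2)%N := leq_mul le_a le_b.
have le_I : (n * 2 * #|<[a]> :&: <[b]>| <= #[a] * #[b])%N.
  by rewrite [X in (_ <= X)%N]Ecard leq_mul2r muln2 le_G orbT.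
have I1 : #|<[a]> :&: <[b]>| = 1%N.
  apply/eqP; rewrite eqn_leq I_gt0 andbT -(leq_pmul2l (m := (n * 2)%N)).
    by rewrite muln1 (leq_trans le_I).
  by rewrite muln_gt0 n_gt0.
rewrite I1 !muln1 in le_I Ecard.
have Eab : (#[a] * #[b] = n * 2)%N by apply/eqP; rewrite eqn_leq le_ab.
have a_n : #[a] = n.
  apply/eqP; rewrite eqn_leq le_a -(leq_pmul2r (m := 2)) // -Eab.
  by rewrite leq_mul2l le_b orbT.
split=> //.
- by move/eqP: Eab; rewrite a_n eqn_pmul2l // => /eqP.
- by apply: card_le1_trivg; rewrite I1.
- by rewrite -muln2 -Eab [RHS]Ecard.
Qed.

(** The two powers of [a] differ by an element of the trivial intersection of
    [<[a]>] and [<[b]>]. *)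
Lemma dihedral_expg_mod (i j : nat) (e f : bool) :
  a ^+ i * b ^+ e = a ^+ j * b ^+ f -> i = j %[mod n] /\ e = f.
Proof.
have [a_n b_2 Iab _] := dihedral_orders => Eij.
have Ec : (a ^+ j)^-1 * a ^+ i = b ^+ f * (b ^+ e)^-1.
  by apply: (mulgI (a ^+ j)); rewrite mulKVg mulgA -Eij mulgK.
have : (a ^+ j)^-1 * a ^+ i \in <[a]> :&: <[b]>.
  by rewrite inE {2}Ec !groupM ?groupV ?mem_cycle.
rewrite Iab => /set1P Ec1; split.
  by apply/eqP; rewrite -a_n -eq_expg_mod_order eq_sym eq_mulVg1 Ec1.
move/eqP: Ec1; rewrite Ec -eq_mulgV1 eq_expg_mod_order b_2.
by case: (e) (f) => -[].
Qed.

(** Normal forms [a ^ k * b ^ e], with [k] read modulo [n]. The multiplier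
    [n.-1] stands for [-1]: moving [b] past [a ^ k] inverts it. *)
Lemma dihedral_coordinates :
  exists (k : gT -> nat) (e : gT -> bool),
  [/\ forall g, g = a ^+ k g * b ^+ e g,
      (k a = 1 %[mod n])%N, e b,
      forall g h, k (g * h)%g = (k g + (if e g then n.-1 else 1) * k h)%N %[mod n]
    & forall g h, e (g * h) = e g (+) e h].
Proof.
have [a_n b_2 _ _] := dihedral_orders.
have : forall g, exists ke : nat * bool, g = a ^+ ke.1 * b ^+ ke.2.
  move=> g; have : g \in <[a]> * <[b]> by rewrite dihedral_cycle_mul inE.
  case/mulsgP=> _ _ /cycleP[i ->] /cycleP[j ->] ->; exists (i, odd j) => /=.
  by rewrite -modn2 -b_2 expg_mod_order.
case/fin_all_exists=> ke ke_g.
have bC i (e : bool) : b ^+ e * a ^+ i = a ^+ ((if e then n.-1 else 1) * i)%N * b ^+ e.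
  case: e; last by rewrite !mul1g mulg1 mul1n.
  have -> : a ^+ (n.-1 * i) = (a ^+ i) ^ b^-1.
    rewrite conjXg -[a]invgK conjVg -{2}dihedral_conj conjgK expgM.
    by rewrite !invgK invg_expg a_n.
  by rewrite expg1 conjgE invgK -!mulgA mulVg mulg1.
exists (fun g => (ke g).1), (fun g => (ke g).2).
have keM g h : let: (i, e) := ke g in let: (j, f) := ke h in
    g * h = a ^+ (i + (if e then n.-1 else 1) * j)%N * b ^+ (e (+) f).
  case Eg: (ke g) => [i e]; case Eh: (ke h) => [j f].
  rewrite (ke_g g) (ke_g h) Eg Eh /=.
  rewrite -mulgA (mulgA _ (a ^+ j)) bC -!mulgA -expgD mulgA -expgD; congr (_ * _).
  by apply/eqP; rewrite eq_expg_mod_order b_2; case: (e) (f) => -[].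
split=> //.
- have : a ^+ (ke a).1 * b ^+ (ke a).2 = a ^+ 1 * b ^+ false.
    by rewrite -ke_g mulg1.
  by case/dihedral_expg_mod.
- have : a ^+ (ke b).1 * b ^+ (ke b).2 = a ^+ 0 * b ^+ true.
    by rewrite -ke_g mul1g.
  by case/dihedral_expg_mod.
- move=> g h; have := keM g h; rewrite {1}(ke_g (g * h)).
  by case: (ke g) (ke h) => [i e] [j f] /dihedral_expg_mod[].
- move=> g h; have := keM g h; rewrite {1}(ke_g (g * h)).
  by case: (ke g) (ke h) => [i e] [j f] /dihedral_expg_mod[].
Qed.

End Dihedral.

(** * Linear maps on a group algebra *)

Section Basis.
Variables (F : fieldType) (gT : finGroupType).
Local Notation FG := (group_algebra F gT).
Local Notation delta := (@gdelta F gT).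
Implicit Types u v w : FG.

Lemma gdeltaE g h : gcoef (delta g) h = (h == g)%:R.
Proof. exact: gmkE. Qed.

Lemma gcoefB u v g : gcoef (u - v) g = gcoef u g - gcoef v g.
Proof. by rewrite -scaleN1r gcoefD gcoefZ mulN1r. Qed.

Lemma gcoef_mulr_delta u g h : gcoef (u * delta g) h = gcoef u (h * g^-1)%g.
Proof.
rewrite [LHS]gmkE (bigD1 (h * g^-1)%g) //= gdeltaE invMg invgK mulgKV eqxx mulr1.
rewrite big1 ?addr0 // => k; rewrite gdeltaE => kh.
have /negPf-> : (k^-1 * h != g)%g.
  by apply: contra kh => /eqP <-; rewrite invMg invgK mulgA mulgV mul1g.
by rewrite mulr0.
Qed.

Lemma gcoef_mull_delta u g h : gcoef (delta g * u) h = gcoef u (g^-1 * h)%g.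
Proof.
rewrite [LHS]gmkE (bigD1 g) //= gdeltaE eqxx mul1r.
by rewrite big1 ?addr0 // => k /negPf kg; rewrite gdeltaE kg mul0r.
Qed.

Lemma gdeltaM g h : delta g * delta h = delta (g * h)%g.
Proof.
by apply/gcoefP=> k; rewrite gcoef_mulr_delta !gdeltaE (can2_eq (mulgKV h) (mulgK h)).
Qed.

Lemma gdelta_sum u : u = \sum_(g : gT) gcoef u g *: delta g.
Proof.
apply/gcoefP=> h; rewrite /gcoef sum_ffunE (bigD1 h) //=.
rewrite big1 ?addr0 => [|g gh]; rewrite ffunE.
  by rewrite -[X in _ *: X]/(gcoef (delta h) h) gdeltaE eqxx [_ *: _]mulr1.
rewrite -[X in _ *: X]/(gcoef (delta g) h) gdeltaE eq_sym (negPf gh).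
exact: scaler0.
Qed.

(** Linear identities need only be checked on group elements; used twice in a
    row, this covers the bilinear ones. *)
Lemma gdelta_ind (P : FG -> Prop) :
    P 0 -> (forall c u v, P u -> P v -> P (c *: u + v)) ->
  (forall g, P (delta g)) -> forall u, P u.
Proof.
move=> P0 Plin Pdelta u; rewrite (gdelta_sum u).
by elim/big_ind: _ => // [v w Pv Pw|g _];
   [rewrite -[v]scale1r | rewrite -[_ *: _]addr0]; apply: Plin.
Qed.

Definition gext (d : gT -> FG) u : FG := \sum_(g : gT) gcoef u g *: d g.

Lemma gext_is_linear d : linear (gext d).
Proof.
move=> c u v; rewrite /gext scaler_sumr -big_split; apply: eq_bigr => g _ /=.
by rewrite gcoefD gcoefZ scalerDl scalerA.
Qed.

HB.instance Definition _ d :=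
  GRing.isLinear.Build F FG FG *:%R (gext d) (gext_is_linear d).

Lemma gext_delta d g : gext d (delta g) = d g.
Proof.
rewrite /gext (bigD1 g) //= gdeltaE eqxx scale1r big1 ?addr0 // => h /negPf hg.
by rewrite gdeltaE hg scale0r.
Qed.

End Basis.

(** * Derivations twisted by a group endomorphism *)

Section Twisted.
Local Open Scope quotient_scope.
Variables (F : fieldType) (gT : finGroupType).
Variable phi : {morphism [set: gT]%g >-> gT}.
Local Notation FG := (group_algebra F gT).
Local Notation delta := (@gdelta F gT).
Local Notation sigma := (linear_extension (F := F) phi).

(** Replacing [linear_extension] by [gext] gives access to its linearity. *)
Lemma sigmaE : sigma = gext (delta \o phi). Proof. by []. Qed.

Lemma sigma_delta g : sigma (delta g) = delta (phi g).
Proof. by rewrite sigmaE gext_delta. Qed.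

Lemma sigma_mul (u v : FG) : sigma (u * v) = sigma u * sigma v.
Proof.
rewrite sigmaE.
elim/gdelta_ind: u => [|c u1 u2 IH1 IH2|g]; first by rewrite mul0r !linear0 mul0r.
  by rewrite mulrDl -gscalerAl !linearP /= IH1 IH2 mulrDl -gscalerAl.
elim/gdelta_ind: v => [|c u1 u2 IH1 IH2|h]; first by rewrite mulr0 !linear0 mulr0.
  by rewrite mulrDr -gscalerAr !linearP /= IH1 IH2 mulrDr -gscalerAr.
by rewrite gdeltaM !gext_delta /= gdeltaM morphM ?inE.
Qed.

Lemma Inn_sub_Der : {subset Inn sigma <= Der sigma}.
Proof.
move=> D /InnP[w Dw]; apply/DerP => u v.
rewrite !Dw sigma_mul mulrBl mulrBr !mulrA addrA; congr (_ - _).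
by rewrite subrK.
Qed.

Lemma derivation_basis (D : 'End(FG)) :
    (forall g h, D (delta (g * h)%g)
       = D (delta g) * delta (phi h) + delta (phi g) * D (delta h)) ->
  D \in Der sigma.
Proof.
move=> Dgh; apply/DerP => u v; rewrite sigmaE.
elim/gdelta_ind: u => [|c u1 u2 IH1 IH2|g].
- by rewrite mul0r !linear0 !mul0r addr0.
- rewrite mulrDl -gscalerAl !linearP /= IH1 IH2 !mulrDl -!gscalerAl scalerDr.
  by rewrite addrACA.
elim/gdelta_ind: v => [|c u1 u2 IH1 IH2|h].
- by rewrite mulr0 !linear0 !mulr0 addr0.
- rewrite mulrDr -gscalerAr !linearP /= IH1 IH2 !mulrDr -!gscalerAr scalerDr.
  by rewrite addrACA.
by rewrite gdeltaM Dgh !gext_delta.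
Qed.

(** Averaging: let [W] be the sum of the cocycle values
    [D (delta g) * delta (phi g)^-1] over all [g]. By the cocycle identity,
    conjugating [W] by [phi h] permutes the terms and subtracts the value at [h]
    from each of them, so [W] divided by the order of the group implements
    [D]. *)
Lemma Der_sub_Inn : #|[set: gT]|%:R != 0 :> F -> {subset Der sigma <= Inn sigma}.
Proof.
move=> G0 D /DerP HD.
pose W : FG := \sum_g D (delta g) * delta (phi g^-1%g).
have DW h : delta (phi h) * W = W * delta (phi h) - #|[set: gT]|%:R *: D (delta h).
  (* Reindex by left translation, so that both sums run over D (h * g). *)
  have -> : W * delta (phi h) = \sum_g D (delta (h * g)%g) * delta (phi g^-1%g).
    rewrite /W (reindex_inj (mulgI h)) mulr_suml; apply: eq_bigr => g _ /=.
    by rewrite -mulrA gdeltaM -morphM ?inE // invMg mulgKV.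
  rewrite cardsT scaler_nat -sumr_const -sumrB mulr_sumr; apply: eq_bigr => g _.
  rewrite -gdeltaM HD !sigma_delta mulrDl -!mulrA gdeltaM -morphM ?inE //.
  rewrite mulgV morph1 -[delta 1%g]/(1 : FG) mulr1.
  by rewrite [X in X - _]addrC addrK.
pose w : FG := #|[set: gT]|%:R^-1 *: W.
apply/InnP; exists w => u; rewrite sigmaE.
elim/gdelta_ind: u => [|c u v IHu IHv|h].
- by rewrite !linear0 mulr0 mul0r subr0.
- rewrite !linearP /= IHu IHv mulrDl mulrDr -(gscalerAr c w).
  by rewrite -(gscalerAl c _ w) opprD scalerBr addrACA.
rewrite gext_delta /= /w -gscalerAl -gscalerAr -scalerBr DW opprB addrC subrK.
by rewrite scalerA mulVf // scale1r.
Qed.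

(** The obstruction to being inner: [w] and its conjugate by [phi g] have the
    same coefficient at any [x] that commutes with [phi g]. *)
Lemma inner_gcoef (D : 'End(FG)) (g x : gT) :
  is_inner sigma D -> commute x (phi g) -> gcoef (D (delta g)) (x * phi g)%g = 0.
Proof.
case=> w Dw cxg; rewrite Dw sigma_delta gcoefB gcoef_mulr_delta gcoef_mull_delta.
by rewrite mulgK cxg mulKg subrr.
Qed.

Lemma noninner_derivation (d : gT -> FG) (g x : gT) :
    (forall g h, d (g * h)%g = d g * delta (phi h) + delta (phi g) * d h) ->
    commute x (phi g) -> gcoef (d g) (x * phi g)%g != 0 ->
  exists2 D, D \in Der sigma & D \notin Inn sigma.
Proof.
move=> dM cxg dx; have Dd h : linfun (gext d) (delta h) = d h.
  by rewrite lfunE /= gext_delta.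
exists (linfun (gext d)); first by apply: derivation_basis => h k; rewrite !Dd.
by apply: contra dx => /InnP/inner_gcoef/(_ cxg); rewrite Dd => ->.
Qed.

(** [H^1(G, F) = Hom(G, F)] embeds in the outer derivations, because the
    multiples of the unit are a direct summand of the algebra for the
    conjugation action: the coefficient at [1] splits them off. *)
Lemma noninner_additive_character (chi : gT -> F) (g : gT) :
    (forall h k, chi (h * k)%g = chi h + chi k) -> chi g != 0 ->
  exists2 D, D \in Der sigma & D \notin Inn sigma.
Proof.
move=> chiM chig.
apply: (@noninner_derivation (fun h => chi h *: delta (phi h)) g 1%g).
- move=> h k; rewrite -gscalerAl -gscalerAr gdeltaM -scalerDl chiM.
  by rewrite morphM ?inE.
- by apply: commute_sym; apply: commute1.
- by rewrite mul1g gcoefZ gdeltaE eqxx mulr1.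
Qed.

Lemma Out_trivial : {subset Der sigma <= Inn sigma} ->
  forall x : Out sigma, x = 0.
Proof.
move=> DI; elim/quotW=> D.
rewrite -[0](raddf0 (\pi_(Out sigma))); apply/eqP.
by rewrite -Quotient.idealrBE subr0; apply: DI; apply: valP D.
Qed.

Lemma Out_nontrivial D : D \in Der sigma -> D \notin Inn sigma ->
  exists x : Out sigma, x <> 0.
Proof.
move=> DD DI; pose D' : derivation_space sigma := Sub D DD.
exists (\pi_(Out sigma) D'); rewrite -[0](raddf0 (\pi_(Out sigma))) => /eqP.
by rewrite -Quotient.idealrBE subr0 inE SubK; apply/negP.
Qed.

End Twisted.

(** * Outer derivations of the dihedral group algebra *)

Section DihedralOuter.
Variables (n : nat) (gT : finGroupType) (a b : gT).
Hypotheses (n_gt2 : (2 < n)%N) (Hab : dihedral_presentation n a b).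
Variables (F : fieldType) (phi : {morphism [set: gT]%g >-> gT}) (s t : nat).
Hypotheses (phi_a : phi a = (a ^+ s)%g) (phi_b : phi b = (a ^+ t * b)%g).
Local Notation FG := (group_algebra F gT).
Local Notation delta := (@gdelta F gT).
Local Notation sigma := (linear_extension (F := F) phi).
Let n_gt1 : (1 < n)%N := ltnW n_gt2.

Lemma noninner_char2 : 2%N \in [pchar F] ->
  exists2 D, D \in Der sigma & D \notin Inn sigma.
Proof.
move=> F2; have [k [e [_ _ eb _ eM]]] := dihedral_coordinates n_gt1 Hab.
apply: (@noninner_additive_character _ _ phi (fun g => (e g)%:R) b).
  move=> g h; rewrite eM; case: (e g) (e h) => -[]; rewrite /= ?addr0 ?add0r //.
  by rewrite -(natrD _ 1 1); apply/esym/(pcharf0 F2).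
by rewrite eb oner_neq0.
Qed.

(** Conjugation by [phi g] acts on the line through [delta a - delta a^-1] by a
    sign: rotations commute with [a], and reflections invert it, whatever [s]
    and [t] are. *)
Lemma phi_conj_antisym (g : gT) (i : nat) (e : bool) : g = (a ^+ i * b ^+ e)%g ->
  delta (phi g) * (delta a - delta a^-1%g)
  = (-1) ^+ e *: ((delta a - delta a^-1%g) * delta (phi g)).
Proof.
move=> ->; have [j ->] : exists j, phi (a ^+ i * b ^+ e)%g = (a ^+ j * b ^+ e)%g.
  rewrite morphM ?inE // !morphX ?inE // phi_a phi_b -expgM.
  case: e; last by exists (s * i)%N.
  by exists (s * i + t)%N; rewrite !expg1 mulgA -expgD.
have commXa x : x \in <[a]>%g -> (a ^+ j * x = x * a ^+ j)%g.
  by case/cycleP=> l ->; rewrite -!expgD addnC.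
have b2 : (b ^+ 2 = 1)%g by case: Hab.
rewrite mulrBr mulrBl !gdeltaM; case: e.
  have bx x : x \in <[a]>%g -> (b * x = x^-1 * b)%g.
    case/cycleP=> l ->; rewrite -expgVn -(dihedral_conj Hab) -conjXg.
    by rewrite conjgE (dihedral_invb Hab) -!mulgA -expg2 b2 mulg1.
  rewrite expg1 expr1 scaleN1r opprB -!mulgA !bx ?groupV ?cycle_id //.
  by rewrite invgK !mulgA !commXa ?groupV ?cycle_id.
by rewrite mulg1 expr0 scale1r !commXa ?groupV ?cycle_id.
Qed.

(** The stabiliser of [a] under conjugation through [phi] is [<[a]>], which has
    the nonzero homomorphism [a |-> 1] to a field where [n] vanishes. By
    Shapiro's lemma this yields a cohomology class supported on the orbit of
    [a]; the derivation [d] is its explicit form, with [k g] the rotation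
    coordinate of [g]. *)
Lemma noninner_pchar_dvd p : p \in [pchar F] -> (p %| n)%N ->
  exists2 D, D \in Der sigma & D \notin Inn sigma.
Proof.
move=> Fp p_n; have [k [e [ke ka _ kM _]]] := dihedral_coordinates n_gt1 Hab.
have n0 : n%:R = 0 :> F by apply/eqP; rewrite -(dvdn_pcharf Fp).
have natr_mod i j : (i = j %[mod n])%N -> i%:R = j%:R :> F.
  have modF l : l%:R = (l %% n)%:R :> F.
    by rewrite {1}(divn_eq l n) natrD natrM n0 mulr0 add0r.
  by rewrite (modF i) (modF j) => ->.
pose d g : FG := (k g)%:R *: ((delta a - delta a^-1%g) * delta (phi g)).
apply: (@noninner_derivation _ _ phi d a a).
- move=> g h; rewrite /d (natr_mod _ _ (kM g h)) morphM ?inE // -gdeltaM.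
  rewrite -gscalerAl -gscalerAr [in RHS]mulrA (phi_conj_antisym (ke g)).
  rewrite -gscalerAl scalerA -!mulrA -scalerDl natrD natrM [in RHS]mulrC.
  (* The multiplier n.-1 is the sign -1, as n vanishes in F. *)
  congr ((_ + _ * _) *: _); case: (e g) => //.
  by rewrite expr1 -subn1 natrB ?n0 ?sub0r // ltnW.
- by rewrite phi_a; apply: commuteX.
rewrite /d gcoefZ gcoef_mulr_delta mulgK gcoefB !gdeltaE eqxx.
have /negPf-> : (a != a^-1)%g.
  have [a_n _ _ _] := dihedral_orders n_gt1 Hab.
  rewrite -[a in X in X != _]invgK eq_invg_mul -invMg invg_eq1 -expg2 -order_dvdn a_n.
  by rewrite gtnNdvd.
by rewrite (natr_mod _ _ ka) subr0 mulr1 oner_neq0.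
Qed.

End DihedralOuter.

Theorem corollary5p13
  (n : nat) (Hn : (3 <= n)%N)
  (gT : finGroupType) (a b : gT) (Hab : dihedral_presentation n a b)
  (F : fieldType)
  (s t : nat) (Ht : (0 <= t <= n - 1)%N)
  (Hs_odd : odd n -> (1 <= s <= n - 1)%N)
  (Hs_even : ~~ odd n -> [/\ (0 <= s <= n - 1)%N, s <> 0%N & s <> n./2])
  (phi : {morphism [set: gT]%g >-> gT})
  (phi_a : phi a = (a ^+ s)%g) (phi_b : phi b = (a ^+ t * b)%g) :
  let sigma := linear_extension (F := F) phi in
  (([pchar F]%R =i pred0 \/
    exists2 p : nat, p \in [pchar F]%R & odd p /\ gcdn n p = 1%N) ->
   Inn sigma =i Der sigma /\ forall x : Out sigma, x = 0%R)
  /\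
  ((2%N \in [pchar F]%R \/
    exists2 p : nat, p \in [pchar F]%R & gcdn n p <> 1%N) ->
   ({subset Inn sigma <= Der sigma} /\ ~ {subset Der sigma <= Inn sigma})
   /\ exists x : Out sigma, x <> 0%R).
Proof.
move=> sigma.
have n_gt1 : (1 < n)%N := ltnW Hn.
split=> [charF | charF].
  have G0 : #|[set: gT]|%:R != 0 :> F.
    have [_ _ _ ->] := dihedral_orders n_gt1 Hab.
    have n_gt0 : (0 < n)%N := ltnW n_gt1.
    case: charF => [/pcharf0P-> | [p Fp [odd_p gcd_np]]].
      by rewrite double_eq0 -lt0n.
    have p_pr := pcharf_prime Fp.
    rewrite -(dvdn_pcharf Fp) -muln2 Euclid_dvdM // negb_or.
    rewrite -!prime_coprime // coprime_sym /coprime gcd_np eqxx /=.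
    by rewrite -[gcdn _ _ == 1%N]/(coprime p 2) coprimen2.
  have DI := Der_sub_Inn G0; split; last exact: Out_trivial.
  by move=> D; apply/idP/idP; [apply: Inn_sub_Der | apply: DI].
have [D DD DI] : exists2 D, D \in Der sigma & D \notin Inn sigma.
  case: charF => [F2 | [p Fp gcd_np]]; first exact: (noninner_char2 Hn Hab).
  apply: (noninner_pchar_dvd Hn Hab phi_a phi_b Fp).
  apply: contraT; rewrite -prime_coprime ?(pcharf_prime Fp) //.
  by rewrite coprime_sym => /eqP.
split; last exact: Out_nontrivial DD DI.
by split; [apply: Inn_sub_Der | move=> /(_ D DD); apply/negP].
Qed.
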